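(* For any $n\in\mathbb N$ there is a unital Banach algebra $\mathcal{A}_n$ with $C'_{\mathrm{DI}}(\mathcal{A}_n)=1$ and yet $C_{\mathrm{DI}}(\mathcal{A}_n)\ge n$.
   Context: Banach algebras are complex and have a contractive product $\|ab\|\le\|a\|\|b\|$; a unital Banach algebra has unit $1$ with $\|1\|=1$. Two idempotents $p,q$ in an algebra $\mathcal A$ are equivalent, $p\sim q$, if there are $a,b\in\mathcal A$ with $p=ab$ and $q=ba$. For a unital Banach algebra $\mathcal A$, $$C_{\mathrm{DI}}(\mathcal A)=\inf\{\|a\|\|b\| : a,b\in\mathcal A,\ ab=1,\ ba\neq 1\},$$ $$C'_{\mathrm{DI}}(\mathcal A)=\inf\{\|p\| : p\in\mathcal A,\ p^2=p,\ p\sim 1,\ p\neq 1\},$$ with $\inf\emptyset=+\infty$. *)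

(* Defs.v *)
From HB Require Import structures.
From mathcomp Require Import all_boot all_order all_algebra.
From mathcomp Require Import all_classical all_reals all_analysis.
From mathcomp.real_closed Require Import complex.

Set Implicit Arguments.
Unset Strict Implicit.
Unset Printing Implicit Defensive.

Import GRing.Theory Num.Theory.
Import numFieldNormedType.Exports.

Local Open Scope classical_set_scope.
Local Open Scope ring_scope.

(* The norm is a field of its own because Hierarchy Builder rejects the join of
   completeNormedModType and algType (numDomainType already lies above both).
   In bnormZ, `|z| is the modulus as an element of R[i], with zero imaginary
   part; its real part is the modulus as an element of R. *)
HB.mixin Record Algebra_isUnitalBanachAlgebra (R : realType) A
    & GRing.Algebra R[i] A := {
  bnorm : A -> R ;
  ler_bnormD : forall a b : A, bnorm (a + b) <= bnorm a + bnorm b ;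
  bnormZ : forall (z : R[i]) (a : A), bnorm (z *: a) = complex.Re `|z| * bnorm a ;
  bnorm_eq0 : forall a : A, bnorm a = 0 -> a = 0 ;
  ler_bnormM : forall a b : A, bnorm (a * b) <= bnorm a * bnorm b ;
  bnorm1 : bnorm 1 = 1 ;
  bnorm_complete : forall u : nat -> A,
    (forall e : R, 0 < e -> exists N : nat, forall m n : nat,
       (N <= m)%N -> (N <= n)%N -> bnorm (u m - u n) < e) ->
    exists l : A, bnorm (u n - l) @[n --> \oo] --> (0 : R) }.

#[short(type="unitalBanachAlgType")]
HB.structure Definition UnitalBanachAlgebra (R : realType) :=
  {A of GRing.Algebra R[i] A & Algebra_isUnitalBanachAlgebra R A}.

Definition idempotent_equiv (A : nzRingType) (p q : A) : Prop :=
  exists a b : A, p = a * b /\ q = b * a.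

(* The infima live in \bar R because ereal_inf set0 = +oo. *)
Definition CDI (R : realType) (A : unitalBanachAlgType R) : \bar R :=
  ereal_inf [set x : \bar R | exists a b : A,
    [/\ a * b = 1, b * a <> 1 & x = (bnorm a * bnorm b)%:E]].

Definition CDI' (R : realType) (A : unitalBanachAlgType R) : \bar R :=
  ereal_inf [set x : \bar R | exists p : A,
    [/\ p * p = p, idempotent_equiv p 1, p <> 1 & x = (bnorm p)%:E]].

(* Main.v *)
Require Import Defs.
From HB Require Import structures.
From mathcomp Require Import all_boot all_order all_algebra.
From mathcomp Require Import all_classical all_reals all_analysis.
From mathcomp Require Import ring lra.
From mathcomp.real_closed Require Import complex.

(** On the bounded operators on [l^oo(nat)], let [L] and [R] be the left and right
    shifts, so that [L R = 1] while [p = R L <> 1] is an idempotent of norm 1.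
    The commutative subalgebra [S] spanned by [1] and [p] gives, for [k >= 1], the
    equivalent algebra norm [P a = inf_(s in S) (N s + k * N (a - s))].  It equals
    [N] on [S], so [P p = 1] and C'_DI = 1.  As elements of [S] commute,
    [k * N (a b - b a) <= 2 * P a * P b].  If [a b = 1 <> b a], then
    [a b - b a = 1 - b a] is a nonzero idempotent, so [N (a b - b a) >= 1] and
    [P a * P b >= k / 2]; it remains to take [k >= 2 n]. *)

Set Implicit Arguments.
Unset Strict Implicit.
Unset Printing Implicit Defensive.

Import Order.TTheory GRing.Theory Num.Theory.
Import numFieldNormedType.Exports.
Import ComplexField.Normc.

Local Open Scope classical_set_scope.
Local Open Scope ring_scope.

(** For [0 < k], dividing by [k] reduces the claim to the greatest lower bound property; for
    [k = 0], a member of [E] supplies [c <= 0]. *)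
Lemma le_scale_inf (R : realType) (E : set R) (c k : R) :
  E !=set0 -> 0 <= k -> (forall x, E x -> c <= k * x) -> c <= k * inf E.
Proof.
move=> E0; rewrite le_eqVlt => /predU1P[<- cE|k0 cE].
  by have [x /cE] := E0; rewrite !mul0r.
rewrite -ler_pdivrMl//; apply: lb_le_inf => // x /cE.
by rewrite ler_pdivrMl.
Qed.

(** * The real-valued modulus of a complex number *)

Section ComplexModulus.
Variable R : realType.
Implicit Type z : R[i].

Lemma normc_ge0 z : 0 <= normc z.
Proof. by case: z => x y; exact: sqrtr_ge0. Qed.

Lemma ger_normc_Re z : `|complex.Re z| <= normc z.
Proof. by case: z => x y /=; rewrite -sqrtr_sqr ler_wsqrtr// lerDl sqr_ge0. Qed.

Lemma ger_normc_Im z : `|complex.Im z| <= normc z.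
Proof. by case: z => x y /=; rewrite -sqrtr_sqr ler_wsqrtr// lerDr sqr_ge0. Qed.

Lemma normc_le_ReIm z : normc z <= `|complex.Re z| + `|complex.Im z|.
Proof.
case: z => x y /=; rewrite -[leRHS]ger0_norm ?addr_ge0// -sqrtr_sqr ler_wsqrtr//.
by rewrite sqrrD !real_normK ?num_real// lerD2r lerDl mulrn_wge0 ?mulr_ge0.
Qed.

End ComplexModulus.

(** * Cauchy sequences and limits in epsilon form *)

Section EpsilonCauchy.
Variable R : realType.

(** [N] is an arbitrary function, so completeness can be discussed before [N] is known to be a norm
    and without a topology on [V]. *)
Definition eps_cauchy (V : zmodType) (N : V -> R) (u : nat -> V) :=
  forall e : R, 0 < e -> exists n0 : nat, forall m n : nat,
    (n0 <= m)%N -> (n0 <= n)%N -> N (u m - u n) < e.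

Definition eps_cvg (V : zmodType) (N : V -> R) (u : nat -> V) (l : V) :=
  forall e : R, 0 < e -> exists n0 : nat, forall n : nat,
    (n0 <= n)%N -> N (u n - l) < e.

Lemma eps_cvgP (V : zmodType) (N : V -> R) (u : nat -> V) (l : V) :
  (forall a, 0 <= N a) -> eps_cvg N u l -> N (u n - l) @[n --> \oo] --> (0 : R).
Proof.
move=> N0 ul; apply/cvgr0Pnorm_lt => e /ul[n0 n0P].
by exists n0 => // n /= /n0P; rewrite ger0_norm.
Qed.

Lemma eps_cauchy_real (u : nat -> R) :
  eps_cauchy Num.norm u -> exists l, eps_cvg Num.norm u l.
Proof.
move=> cu.
have : cvg (u @ \oo).
  apply/cauchy_cvgP/cauchy_exP => e /cu[n0 n0P].
  by exists (u n0); exists n0 => // n /= nn0; exact: n0P.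
move=> /cvgrPdistC_lt ul; exists (lim (u @ \oo)) => e /ul[n0 _ n0P].
by exists n0.
Qed.

Lemma eps_cauchy_complex (u : nat -> R[i]) :
  eps_cauchy (@normc R) u -> exists l, eps_cvg (@normc R) u l.
Proof.
move=> cu.
have [e /cu[n0 n0P]|x xP] := @eps_cauchy_real (fun n => complex.Re (u n)).
  exists n0 => m n mn0 nn0; rewrite -raddfB.
  by apply: le_lt_trans (ger_normc_Re _) _; exact: n0P.
have [e /cu[n0 n0P]|y yP] := @eps_cauchy_real (fun n => complex.Im (u n)).
  exists n0 => m n mn0 nn0; rewrite -raddfB.
  by apply: le_lt_trans (ger_normc_Im _) _; exact: n0P.
exists (x +i* y)%C => e e0.
have [n1 n1P] := xP _ (divr_gt0 e0 (ltr0n _ 2)).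
have [n2 n2P] := yP _ (divr_gt0 e0 (ltr0n _ 2)).
exists (maxn n1 n2) => n; rewrite geq_max => /andP[nn1 nn2].
apply: le_lt_trans (normc_le_ReIm _) _.
have {n1P}/n1P := nn1; have {n2P}/n2P := nn2.
by rewrite !raddfB/=; lra.
Qed.

(** Serves to transfer linearity to a pointwise limit of operators. *)
Lemma eps_cvg_unique (u : nat -> R[i]) l l' :
  eps_cvg (@normc R) u l -> eps_cvg (@normc R) u l' -> l = l'.
Proof.
move=> ul ul'; apply/subr0_eq/eq0_normc/le_anti; rewrite normc_ge0 andbT.
apply/ler_addgt0Pr => e e0; rewrite add0r.
have [n nP] := ul _ (divr_gt0 e0 (ltr0n _ 2)).
have [n' n'P] := ul' _ (divr_gt0 e0 (ltr0n _ 2)).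
have lun' := n'P _ (leq_maxr n n'); have lun := nP _ (leq_maxl n n').
rewrite -(subrKA (u (maxn n n'))).
apply: le_trans (le_normcD _ _) _; rewrite -(opprB _ l) normcN; lra.
Qed.

Lemma eps_cvg_linear z (u v : nat -> R[i]) l l' :
    eps_cvg (@normc R) u l -> eps_cvg (@normc R) v l' ->
  eps_cvg (@normc R) (fun n => z * u n + v n) (z * l + l').
Proof.
move=> ul vl' e e0; have z0 := normc_ge0 z.
have d0 : 0 < e / 2 / (normc z + 1) by rewrite !divr_gt0// ltr_wpDl.
have [n0 n0P] := ul _ d0; have [n1 n1P] := vl' _ (divr_gt0 e0 (ltr0n _ 2)).
exists (maxn n0 n1) => n; rewrite geq_max => /andP[/n0P lun /n1P lvn].
have -> : z * u n + v n - (z * l + l') = z * (u n - l) + (v n - l') by ring.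
apply: le_lt_trans (le_normcD _ _) _; rewrite normcM.
suff : normc z * normc (u n - l) <= e / 2 by lra.
move: lun; rewrite ltr_pdivlMr ?ltr_wpDl// => /ltW; apply: le_trans.
by rewrite mulrC ler_wpM2l ?normc_ge0// lerDl.
Qed.

End EpsilonCauchy.

(** * Banach algebra norms on a fixed algebra *)

Section BanachNorm.
Variable R : realType.

(** A predicate on functions rather than a structure, because one algebra carries two norms: the
    operator norm and its renorming. *)
Record banach_norm (A : algType R[i]) (N : A -> R) : Prop := BanachNorm {
  banach_normD : forall a b, N (a + b) <= N a + N b ;
  banach_normZ : forall z a, N (z *: a) = normc z * N a ;
  banach_norm_eq0 : forall a, N a = 0 -> a = 0 ;
  banach_normM : forall a b, N (a * b) <= N a * N b ;
  banach_norm1 : N 1 = 1 ;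
  banach_norm_complete :
    forall u, eps_cauchy N u -> exists l, eps_cvg N u l }.

(** The reverse inequality comes from applying the hypothesis to the scalar [z^-1] and the vector
    [z *: a]. *)
Lemma normZ_of_le (V : lmodType R[i]) (N : V -> R) :
  (forall a, 0 <= N a) -> (forall z a, N (z *: a) <= normc z * N a) ->
  forall z a, N (z *: a) = normc z * N a.
Proof.
move=> N0 NZ z a; apply/eqP; rewrite eq_le NZ/=.
have [->|z0] := eqVneq z 0; first by rewrite normc0 mul0r.
have nz : 0 < normc z.
  by rewrite lt_def normc_ge0 andbT; apply: contra_neq z0 => /eq0_normc.
rewrite -ler_pdivlMl// -normcV; apply: le_trans (NZ _ _).
by rewrite scalerA mulVf// scale1r.
Qed.

Section Theory.
Variables (A : algType R[i]) (N : A -> R) (bN : banach_norm N).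

Lemma banach_norm0 : N 0 = 0.
Proof. by rewrite -(scale0r 0) (banach_normZ bN) normc0 mul0r. Qed.

Lemma banach_normN a : N (- a) = N a.
Proof. by rewrite -scaleN1r (banach_normZ bN) normcN normc1 mul1r. Qed.

Lemma banach_norm_ge0 a : 0 <= N a.
Proof.
have := banach_normD bN a (- a); rewrite subrr banach_norm0 banach_normN; lra.
Qed.

End Theory.

(** Submultiplicativity gives [N e <= N e * N e], and the positive factor [N e] cancels. The norm
    axioms appear separately because [opnorm 1 = 1] is itself derived from this bound. *)
Lemma idem_norm_ge1 (A : algType R[i]) (N : A -> R) (e : A) :
    (forall a, 0 <= N a) -> (forall a, N a = 0 -> a = 0) ->
    (forall a b, N (a * b) <= N a * N b) ->
  e * e = e -> e <> 0 -> 1 <= N e.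
Proof.
move=> N0 Neq0 NM ee e0.
have Ne : 0 < N e by rewrite lt_def N0 andbT; apply/eqP => /Neq0.
by have := NM e e; rewrite ee -{1}[N e]mulr1 ler_pM2l.
Qed.

Lemma subr_idem (A : algType R[i]) (e : A) : e * e = e -> (1 - e) * (1 - e) = 1 - e.
Proof. by move=> ee; rewrite mulrBl mul1r mulrBr mulr1 ee subrr subr0. Qed.

Lemma banach_norm_complete_cvg (A : algType R[i]) (N : A -> R) :
  banach_norm N -> forall u, eps_cauchy N u ->
  exists l, N (u n - l) @[n --> \oo] --> (0 : R).
Proof.
move=> bN u /(banach_norm_complete bN)[l ul]; exists l.
by apply: eps_cvgP => //; exact: banach_norm_ge0.
Qed.

Definition banach_pack (A : algType R[i]) (N : A -> R) (bN : banach_norm N) :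
    unitalBanachAlgType R :=
  HB.pack (GRing.Algebra.sort A) (@Algebra_isUnitalBanachAlgebra.Build R A N
    (banach_normD bN) (banach_normZ bN) (banach_norm_eq0 bN) (banach_normM bN)
    (banach_norm1 bN) (banach_norm_complete_cvg bN)).

(** An infimal convolution: the part in [S] costs [N], the rest costs [k * N]. For a subspace [S],
    the unit ball is, up to closure, the convex hull of the unit ball of [S] and the ball of radius
    [1/k] of [A]. *)
Definition renorm (A : algType R[i]) (N : A -> R) (S : set A) (k : R) (a : A) : R :=
  inf [set r | exists2 s, S s & r = N s + k * N (a - s)].

(** * The renormed algebra *)

Section Renorm.
Variables (A : algType R[i]) (N : A -> R) (bN : banach_norm N).
Variables (S : set A) (k : R).
Hypothesis S1 : S 1.
Hypothesis SB : forall s t, S s -> S t -> S (s - t).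
Hypothesis SZ : forall z s, S s -> S (z *: s).
Hypothesis SM : forall s t, S s -> S t -> S (s * t).
Hypothesis k1 : 1 <= k.
Let N0 := banach_norm_ge0 bN.
Let k0 : 0 <= k. Proof. exact: le_trans k1. Qed.

Notation P := (renorm N S k).

Lemma renorm_le a s : S s -> P a <= N s + k * N (a - s).
Proof.
move=> Ss; apply: ge_inf; last by exists s.
by exists 0 => _ [t St ->]; rewrite addr_ge0// mulr_ge0.
Qed.

(** Moves the infimum out of one factor of a product; two uses handle [P a * P b]. *)
Lemma le_scale_renorm a c j : 0 <= j ->
  (forall s, S s -> c <= j * (N s + k * N (a - s))) -> c <= j * P a.
Proof.
move=> j0 ca; apply: le_scale_inf => //.
  by exists (N 1 + k * N (a - 1)); exists 1.
by move=> _ [s Ss ->]; exact: ca.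
Qed.

Lemma le_renorm a c :
  (forall s, S s -> c <= N s + k * N (a - s)) -> c <= P a.
Proof.
move=> ca; rewrite -[P a]mul1r; apply: le_scale_renorm => // s Ss.
by rewrite mul1r ca.
Qed.

Lemma renorm_ge a : N a <= P a.
Proof.
apply: le_renorm => s Ss; rewrite -{1}(subrKC s a).
apply: le_trans (banach_normD bN _ _) _; rewrite lerD2l.
by rewrite ler_peMl.
Qed.

Lemma renorm_ge0 a : 0 <= P a.
Proof. exact: le_trans (renorm_ge a). Qed.

Lemma renorm_subset s : S s -> P s <= N s.
Proof. by move=> /(renorm_le s); rewrite subrr (banach_norm0 bN) mulr0 addr0. Qed.

(** The approximant is [0]. With [renorm_ge] this makes [P] and [N] equivalent. *)
Lemma renorm_le_scale a : P a <= k * N a.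
Proof.
have S0 : S 0 by rewrite -(subrr 1); exact: SB.
by have := renorm_le a S0; rewrite (banach_norm0 bN) subr0 add0r.
Qed.

(** Expanding [a = s + (a - s)] and [b = t + (b - t)], every surviving term contains a remainder. *)
Lemma banach_norm_sub_mul s t a b :
  N (a * b - s * t) <=
    N s * N (b - t) + N (a - s) * N t + N (a - s) * N (b - t).
Proof.
have -> : a * b - s * t = s * (b - t) + (a - s) * t + (a - s) * (b - t).
  by rewrite -addrA -mulrDr subrKC mulrBr mulrBl addrC subrKA.
apply: le_trans (banach_normD bN _ _) _; apply: lerD; last exact: banach_normM.
by apply: le_trans (banach_normD bN _ _) _; apply: lerD; exact: banach_normM.
Qed.

(** If [s] and [t] approximate [a] and [b] from [S], then [s * t] lies in [S] and approximates
    [a * b]. *)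
Lemma renormM a b : P (a * b) <= P a * P b.
Proof.
apply: le_scale_renorm => [|t St]; first exact: renorm_ge0.
rewrite mulrC; apply: le_scale_renorm => [|s Ss].
  by rewrite addr_ge0// mulr_ge0.
apply: le_trans (renorm_le _ (SM Ss St)) _.
have := banach_norm_sub_mul s t a b; have := banach_normM bN s t.
move: (N0 s) (N0 t) (N0 (a - s)) (N0 (b - t)).
move: (N (a * b - _)) (N (s * t)) (N s) (N t) (N (a - s)) (N (b - t)).
move=> r q x u y v x0 u0 y0 v0 qxu rle.
have yv : 0 <= y * v by rewrite mulr_ge0.
have kr : k * r <= k * (x * v + y * u + y * v) by rewrite ler_wpM2l.
(* The product of the two remainders has weight [k] on the left and [k * k] on the right; [1 <= k]
   bridges the two. *)
have kk : k * (y * v) <= k * (k * (y * v)) by rewrite ler_wpM2l// ler_peMl.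
lra.
Qed.

(* Subtracting the commuting parts [s] and [t], only terms carrying a factor
   weighted by [k] in the new norm remain in the commutator. *)
Lemma renorm_commutator a b : (forall s t, S s -> S t -> s * t = t * s) ->
  k * N (a * b - b * a) <= 2 * (P a * P b).
Proof.
move=> SC; rewrite mulrA; apply: le_scale_renorm => [|t St].
  by rewrite mulr_ge0// renorm_ge0.
rewrite mulrAC; apply: le_scale_renorm => [|s Ss].
  by rewrite mulr_ge0// addr_ge0// mulr_ge0.
have -> : a * b - b * a = (a * b - s * t) - (b * a - t * s).
  by rewrite (SC t s)// opprB addrA subrK.
have := banach_normD bN (a * b - s * t) (- (b * a - t * s)).
rewrite (banach_normN bN).
have := banach_norm_sub_mul s t a b; have := banach_norm_sub_mul t s b a.
move: (N0 s) (N0 t) (N0 (a - s)) (N0 (b - t)).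
move: (N (_ - _ - _)) (N (a * b - _)) (N (b * a - _)).
move: (N s) (N t) (N (a - s)) (N (b - t)).
move=> x u y v w r q x0 u0 y0 v0 qle rle wle.
have yv : 0 <= y * v by rewrite mulr_ge0.
have xu : 0 <= x * u by rewrite mulr_ge0.
(* Both [a * b - s * t] and [b * a - t * s] obey the same bound, whence the factor 2. *)
have kr : k * w <= k * (2 * (x * v + y * u + y * v)).
  rewrite ler_wpM2l//; lra.
have kk : k * (y * v) <= k * (k * (y * v)) by rewrite ler_wpM2l// ler_peMl.
lra.
Qed.

Lemma banach_norm_renorm : banach_norm P.
Proof.
have Pe a : P a = 0 -> a = 0.
  move=> Pa; apply: (banach_norm_eq0 bN); apply/le_anti.
  by rewrite N0 andbT -Pa renorm_ge.
split => //.
- move=> a b; rewrite -lerBlDr; apply: le_renorm => s Ss.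
  rewrite lerBlDr -lerBlDl; apply: le_renorm => t St; rewrite lerBlDl.
  have Sst : S (s + t).
    by rewrite -[t]opprK; apply: SB => //; rewrite -scaleN1r; exact: SZ.
  apply: le_trans (renorm_le _ Sst) _; rewrite addrACA -mulrDr.
  apply: lerD; first exact: banach_normD.
  by rewrite ler_wpM2l// opprD addrACA banach_normD.
- apply: normZ_of_le; first exact: renorm_ge0.
  move=> z a; apply: le_scale_renorm => [|s Ss]; first exact: normc_ge0.
  apply: le_trans (renorm_le _ (SZ z Ss)) _.
  by rewrite -scalerBr !(banach_normZ bN) mulrDr mulrCA.
- exact: renormM.
- apply/le_anti; rewrite -{1}(banach_norm1 bN) renorm_subset//.
  by rewrite -(banach_norm1 bN) renorm_ge.
(* A [P]-Cauchy sequence is [N]-Cauchy, and its [N]-limit is a [P]-limit because [P <= k * N]. *)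
- move=> u cu; have [e /cu[n0 n0P]|l ul] := banach_norm_complete bN (u := u).
    exists n0 => m n mn0 nn0; apply: le_lt_trans (renorm_ge _) _; exact: n0P.
  have kp : 0 < k by exact: lt_le_trans k1.
  exists l => e e0; have [n0 n0P] := ul _ (divr_gt0 e0 kp).
  exists n0 => n /n0P; rewrite ltr_pdivlMr// mulrC; apply: le_lt_trans.
  exact: renorm_le_scale.
Qed.

End Renorm.
End BanachNorm.

(** * Bounded complex sequences *)

Section BoundedSequences.
Variable R : realType.

(** [R[i]^o] is the field regarded as a module over itself, so that sequences carry the pointwise
    module structure. *)
Definition bounded_seq : {pred nat -> R[i]^o} :=
  fun x => `[< exists M, forall i, normc (x i) <= M >].

Lemma bounded_seqP (x : nat -> R[i]^o) :
  reflect (exists M, forall i, normc (x i) <= M) (x \in bounded_seq).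
Proof. exact: asboolP. Qed.

Lemma bounded_seq_submod : GRing.submod_closed bounded_seq.
Proof.
split=> [|z x y /bounded_seqP[M xM] /bounded_seqP[M' yM']]; apply/bounded_seqP.
  by exists 0 => i; rewrite normc0.
exists (normc z * M + M') => i; apply: le_trans (le_normcD _ _) _.
by apply: lerD => //; rewrite normcM ler_wpM2l// normc_ge0.
Qed.

HB.instance Definition _ :=
  GRing.isSubmodClosed.Build R[i] (nat -> R[i]^o) bounded_seq bounded_seq_submod.

Record linfty := Linfty {
  linfty_val :> nat -> R[i]^o ; linftyP : linfty_val \in bounded_seq }.

HB.instance Definition _ := [isSub for linfty_val].
HB.instance Definition _ := [Choice of linfty by <:].
HB.instance Definition _ := [SubChoice_isSubLmodule of linfty by <:].

Lemma linfty_ext (x y : linfty) : (forall i, x i = y i) -> x = y.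
Proof. by move=> xy; apply: val_inj; apply/funext => i; exact: xy. Qed.

(** * The algebra of bounded linear operators *)

Implicit Types T : linfty -> linfty.

(* [opbound T C] says that [T] has sup-norm operator bound [C]; quantifying over
   all bounds [M] of [x] avoids introducing the sup norm of [x] itself. *)
Definition opbound T (C : R) := forall (x : linfty) (M : R),
  (forall i, normc (x i) <= M) -> forall i, normc (T x i) <= C * M.

Definition bounded_op : {pred linfty -> linfty} :=
  fun T => `[< linear T /\ exists C, opbound T C >].

Lemma bounded_opP T :
  reflect (linear T /\ exists C, opbound T C) (T \in bounded_op).
Proof. exact: asboolP. Qed.

Lemma opboundD T T' C C' :
  opbound T C -> opbound T' C' -> opbound (T + T') (C + C').
Proof.
move=> TC TC' x M xM i; rewrite mulrDl; apply: le_trans (le_normcD _ _) _.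
by apply: lerD; [exact: TC|exact: TC'].
Qed.

Lemma opboundZ z T C : opbound T C -> opbound (z *: T) (normc z * C).
Proof.
move=> TC x M xM i; rewrite -mulrA.
by rewrite [_ i](_ : _ = z * T x i)// normcM ler_wpM2l ?normc_ge0//; exact: TC.
Qed.

Lemma opbound_comp T T' C C' :
  opbound T C -> opbound T' C' -> opbound (T \o T') (C * C').
Proof. by move=> TC TC' x M xM i; rewrite -mulrA; apply: TC; exact: TC'. Qed.

Lemma opbound_ge0 T C : opbound T C -> 0 <= C.
Proof.
(* The zero sequence admits the bound [M = 1], which isolates [C]. *)
move=> TC; have : forall i, normc ((0 : linfty) i) <= 1 by move=> i; rewrite normc0.
by move=> /TC/(_ 0%N); rewrite mulr1; apply: le_trans; exact: normc_ge0.
Qed.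

Lemma bounded_op_submod : GRing.submod_closed bounded_op.
Proof.
split=> [|z T T' /bounded_opP[lT [C TC]] /bounded_opP[lT' [C' TC']]].
  apply/bounded_opP; split; last by exists 0 => x M _ i; rewrite normc0 mul0r.
  by move=> z x y /=; rewrite scaler0 addr0.
apply/bounded_opP; split.
  move=> c x y.
  have E w : (z *: T + T') w = z *: T w + T' w by [].
  rewrite !E.
  by rewrite lT lT' !scalerDr !scalerA [z * c]mulrC addrACA.
by exists (normc z * C + C'); apply: opboundD => //; exact: opboundZ.
Qed.

HB.instance Definition _ :=
  GRing.isSubmodClosed.Build R[i] (linfty -> linfty) bounded_op bounded_op_submod.

Record linfty_op := LinftyOp {
  op_val :> linfty -> linfty ; op_valP : op_val \in bounded_op }.

HB.instance Definition _ := [isSub for op_val].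
HB.instance Definition _ := [Choice of linfty_op by <:].
HB.instance Definition _ := [SubChoice_isSubLmodule of linfty_op by <:].

Lemma op_ext (a b : linfty_op) : (forall x i, a x i = b x i) -> a = b.
Proof.
by move=> ab; apply: val_inj; apply/funext => x; apply: linfty_ext => i; exact: ab.
Qed.

Lemma op_linear (a : linfty_op) : linear a.
Proof. by have /bounded_opP[] := op_valP a. Qed.

Lemma opD (a : linfty_op) x y : a (x + y) = a x + a y.
Proof. by have := op_linear a 1 x y; rewrite !scale1r. Qed.

Lemma opZ (a : linfty_op) z x : a (z *: x) = z *: a x.
Proof.
have a0 : a 0 = 0 by apply: (addrI (a 0)); rewrite -opD !addr0.
by have := op_linear a z x 0; rewrite a0 !addr0.
Qed.

Lemma op_bounded (a : linfty_op) : exists C, opbound a C.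
Proof. by have /bounded_opP[] := op_valP a. Qed.

Lemma op_one_subproof : id \in bounded_op.
Proof. by apply/bounded_opP; split=> //; exists 1 => x M xM i; rewrite mul1r. Qed.

Lemma op_mul_subproof (a b : linfty_op) : a \o b \in bounded_op.
Proof.
apply/bounded_opP; split; first by move=> z x y /=; rewrite !op_linear.
have [C aC] := op_bounded a; have [C' bC'] := op_bounded b.
by exists (C * C'); exact: opbound_comp.
Qed.

Definition op_one := LinftyOp op_one_subproof.
Definition op_mul a b := LinftyOp (op_mul_subproof a b).

Lemma op_mulA : associative op_mul.
Proof. by move=> a b c; exact: op_ext. Qed.

Lemma op_mul1 : left_id op_one op_mul.
Proof. by move=> a; exact: op_ext. Qed.

Lemma op_mulr1 : right_id op_one op_mul.
Proof. by move=> a; exact: op_ext. Qed.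

Lemma op_mulDl : left_distributive op_mul +%R.
Proof. by move=> a b c; exact: op_ext. Qed.

Lemma op_mulDr : right_distributive op_mul +%R.
Proof.
move=> a b c; apply: op_ext => x i.
exact: (congr1 (fun y : linfty => y i) (opD a (b x) (c x))).
Qed.

Lemma one_in_bounded_seq : (fun=> 1) \in bounded_seq.
Proof. by apply/bounded_seqP; exists 1 => i; rewrite normc1. Qed.

Lemma op_one_neq0 : op_one != 0.
Proof.
apply/eqP => /(congr1 (fun a : linfty_op => a (Linfty one_in_bounded_seq) 0%N)).
by move=> /eqP; rewrite oner_eq0.
Qed.

HB.instance Definition _ := GRing.Zmodule_isNzRing.Build linfty_op
  op_mulA op_mul1 op_mulr1 op_mulDl op_mulDr op_one_neq0.

Lemma op_scaleAl (z : R[i]) (a b : linfty_op) : z *: (a * b) = z *: a * b.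
Proof. exact: op_ext. Qed.

HB.instance Definition _ := GRing.Lmodule_isLalgebra.Build R[i] linfty_op op_scaleAl.

Lemma op_scaleAr (z : R[i]) (a b : linfty_op) : z *: (a * b) = a * (z *: b).
Proof.
apply: op_ext => x i.
exact: (congr1 (fun y : linfty => y i) (esym (opZ a z (b x)))).
Qed.

HB.instance Definition _ := GRing.Lalgebra_isAlgebra.Build R[i] linfty_op op_scaleAr.

(** * The operator norm and its completeness *)

Definition opnorm (a : linfty_op) : R := inf [set C | opbound a C].

Lemma opnorm_le (a : linfty_op) C : opbound a C -> opnorm a <= C.
Proof. by move=> aC; apply: ge_inf => //; exists 0 => D; exact: opbound_ge0. Qed.

(** The infimum is attained: for a fixed sequence with bound [M >= 0], the estimate passes to the
    infimum over [C]. *)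
Lemma opnormP (a : linfty_op) : opbound a (opnorm a).
Proof.
move=> x M xM i; rewrite mulrC; apply: le_scale_inf; first exact: op_bounded.
  by apply: le_trans (xM 0%N); exact: normc_ge0.
by move=> C aC; rewrite mulrC; exact: aC.
Qed.

Lemma opnorm_ge0 a : 0 <= opnorm a.
Proof. exact: opbound_ge0 (@opnormP a). Qed.

Lemma opnorm_eq0 a : opnorm a = 0 -> a = 0.
Proof.
move=> a0; apply: op_ext => x i; have /bounded_seqP[M xM] := linftyP x.
have := @opnormP a x M xM i; rewrite a0 mul0r => ax.
by apply: eq0_normc; apply/le_anti; rewrite ax normc_ge0.
Qed.

Lemma opnormM a b : opnorm (a * b) <= opnorm a * opnorm b.
Proof. by apply: opnorm_le; apply: opbound_comp; exact: opnormP. Qed.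

Lemma opnorm1_le1 : opnorm 1 <= 1.
Proof. by apply: opnorm_le => x M xM i; rewrite mul1r. Qed.

(** Pointwise limits define the limit operator; the Cauchy condition makes convergence uniform over
    sequences with a common bound, which gives boundedness and norm convergence. *)
Lemma opnorm_complete u :
  eps_cauchy opnorm u -> exists a, eps_cvg opnorm u a.
Proof.
move=> cu.
have bnd m n (x : linfty) M (xM : forall i, normc (x i) <= M) i :
    normc (u m x i - u n x i) <= opnorm (u m - u n) * M := @opnormP (u m - u n) x M xM i.
have lim_ex (x : linfty) i : exists l, eps_cvg (@normc R) (fun n => u n x i) l.
  apply: eps_cauchy_complex => e e0; have /bounded_seqP[M xM] := linftyP x.
  have M0 : 0 <= M by apply: le_trans (xM 0%N); exact: normc_ge0.
  (* Dividing by [M + 1] rather than [M] allows [M = 0]. *)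
  have [|n0 n0P] := cu (e / (M + 1)); first by rewrite divr_gt0// ltr_wpDl.
  exists n0 => m n mn0 nn0; apply: le_lt_trans (bnd _ _ _ _ xM _) _.
  have [->|Mn0] := eqVneq M 0; first by rewrite mulr0.
  have Mp : 0 < M by rewrite lt_def Mn0.
  have := n0P m n mn0 nn0; rewrite ltr_pdivlMr ?ltr_wpDl//; apply: le_lt_trans.
  by rewrite ler_wpM2l ?opnorm_ge0// lerDl.
pose f (x : linfty) i := projT1 (cid (lim_ex x i)).
have fP x i : eps_cvg (@normc R) (fun n => u n x i) (f x i) by exact: projT2.
(* Letting [m] tend to infinity in [bnd] along a tail. *)
have near_f e : 0 < e -> exists n0, forall n, (n0 <= n)%N ->
    forall (x : linfty) M, (forall i, normc (x i) <= M) ->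
    forall i, normc (u n x i - f x i) <= e * M.
  move=> /cu[n0 n0P]; exists n0 => n nn0 x M xM i.
  have M0 : 0 <= M by apply: le_trans (xM 0%N); exact: normc_ge0.
  apply/ler_addgt0Pr => d /(fP x i)[n1 n1P].
  have mP := leq_maxl n0 n1; have /n1P/ltW := leq_maxr n0 n1.
  move: (maxn n0 n1) mP => m mn0 fm.
  rewrite -(subrKA (u m x i)); apply: le_trans (le_normcD _ _) _.
  apply: lerD => //; apply: le_trans (bnd _ _ _ _ xM _) _.
  by rewrite ler_wpM2r// ltW// n0P.
have fb x : f x \in bounded_seq.
  apply/bounded_seqP; have /bounded_seqP[M xM] := linftyP x.
  (* One [u n] within distance 1 suffices: [f x] inherits boundedness from [u n x]. *)
  have [n nP] := near_f _ ltr01.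
  exists (opnorm (u n) * M + 1 * M) => i.
  have -> : f x i = u n x i - (u n x i - f x i) by rewrite subKr.
  apply: le_trans (le_normcD _ _) _; rewrite normcN.
  by apply: lerD; [exact: opnormP|exact: nP].
pose F x := Linfty (fb x).
have Flin : linear F.
  move=> z x y; apply: linfty_ext => i.
  (* Both sides are limits of the same sequence, by linearity of each [u n]. *)
  apply: eps_cvg_unique (fP _ _) _.
  have := eps_cvg_linear z (fP x i) (fP y i); congr eps_cvg; apply/funext => n.
  by rewrite op_linear.
have Fbd : exists C, opbound F C.
  have [n nP] := near_f _ ltr01; exists (opnorm (u n) + 1) => x M xM i.
  have -> : F x i = u n x i - (u n x i - f x i) by rewrite subKr.
  rewrite mulrDl; apply: le_trans (le_normcD _ _) _; rewrite normcN.
  by apply: lerD; [exact: opnormP|exact: nP].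
have FP : F \in bounded_op by apply/bounded_opP.
exists (LinftyOp FP) => e e0.
(* [near_f] yields only a non-strict estimate; [e / 2] leaves room for the strict one. *)
have [n0 n0P] := near_f _ (divr_gt0 e0 (ltr0n _ 2)).
exists n0 => n nn0; apply: (@le_lt_trans _ _ (e / 2)); last by lra.
by apply: opnorm_le; exact: n0P.
Qed.

Lemma banach_norm_opnorm : banach_norm opnorm.
Proof.
split.
- by move=> a b; apply: opnorm_le; apply: opboundD; exact: opnormP.
- apply: normZ_of_le; first exact: opnorm_ge0.
  by move=> z a; apply: opnorm_le; apply: opboundZ; exact: opnormP.
- exact: opnorm_eq0.
- exact: opnormM.
(* The lower bound holds because [1] is a nonzero idempotent. *)
- apply/le_anti; rewrite opnorm1_le1/=.
  apply: idem_norm_ge1; rewrite ?mulr1//.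
  + exact: opnorm_ge0.
  + exact: opnorm_eq0.
  + exact: opnormM.
  + by apply/eqP; exact: oner_neq0.
- exact: opnorm_complete.
Qed.

(** * The left and right shifts *)

Lemma lshift_subproof (x : linfty) : (fun i => x i.+1) \in bounded_seq.
Proof.
by have /bounded_seqP[M xM] := linftyP x; apply/bounded_seqP; exists M => i.
Qed.

Lemma rshift_subproof (x : linfty) :
  (fun i => if i is j.+1 then x j else 0) \in bounded_seq.
Proof.
have /bounded_seqP[M xM] := linftyP x; apply/bounded_seqP; exists M => -[|i]//.
by rewrite normc0; apply: le_trans (xM 0%N); exact: normc_ge0.
Qed.

Lemma lshift_opbound : opbound (fun x => Linfty (lshift_subproof x)) 1.
Proof. by move=> x M xM i; rewrite mul1r; exact: xM. Qed.

Lemma rshift_opbound : opbound (fun x => Linfty (rshift_subproof x)) 1.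
Proof.
move=> x M xM [|i]; rewrite mul1r; last exact: xM.
by rewrite [leLHS]normc0; apply: le_trans (xM 0%N); exact: normc_ge0.
Qed.

Lemma lshift_bounded : (fun x => Linfty (lshift_subproof x)) \in bounded_op.
Proof.
apply/bounded_opP; split; last by exists 1; exact: lshift_opbound.
by move=> z x y; exact: linfty_ext.
Qed.

Lemma rshift_bounded : (fun x => Linfty (rshift_subproof x)) \in bounded_op.
Proof.
apply/bounded_opP; split; last by exists 1; exact: rshift_opbound.
move=> z x y; apply: linfty_ext => -[|i]//.
by rewrite [RHS](_ : _ = z * 0 + 0)// mulr0 addr0.
Qed.

Definition lshift_op := LinftyOp lshift_bounded.
Definition rshift_op := LinftyOp rshift_bounded.

Lemma lshiftK : lshift_op * rshift_op = 1.
Proof. exact: op_ext. Qed.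

(** The composite replaces the entry at index 0 by 0, which changes the constant sequence 1. *)
Lemma rshiftl_neq1 : rshift_op * lshift_op <> 1.
Proof.
move=> /(congr1 (fun a : linfty_op => a (Linfty one_in_bounded_seq) 0%N)).
by move=> /esym/eqP; rewrite oner_eq0.
Qed.

Lemma opnorm_rshiftl : opnorm (rshift_op * lshift_op) <= 1.
Proof.
rewrite -(mul1r 1); apply: opnorm_le; apply: opbound_comp.
  exact: rshift_opbound.
exact: lshift_opbound.
Qed.

End BoundedSequences.

(** * The two constants of the renormed algebra *)

Theorem proposition3p12 (R : realType) (n : nat) :
  exists A : unitalBanachAlgType R,
    CDI' A = 1%:E /\ (n%:R%:E <= CDI A)%E.
Proof.
pose p := rshift_op R * lshift_op R.
have pp : p * p = p by rewrite mulrA -(mulrA (rshift_op R)) lshiftK mulr1.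
pose S := [set a | exists s t : R[i], a = s *: 1 + t *: p].
(* The value [2n + 1] gives [2n <= k] and, even for [n = 0], [1 <= k]. *)
pose k : R := (n.*2.+1)%:R.
have bN := banach_norm_opnorm R.
have S1 : S 1 by exists 1, 0; rewrite scale1r scale0r addr0.
have Sp : S p by exists 0, 1; rewrite scale1r scale0r add0r.
have SB s t : S s -> S t -> S (s - t).
  move=> [a [b ->]] [c [d ->]]; exists (a - c), (b - d).
  by rewrite !scalerBl opprD addrACA.
have SZ z s : S s -> S (z *: s).
  by move=> [a [b ->]]; exists (z * a), (z * b); rewrite scalerDr !scalerA.
(* This formula yields both closure under products and commutativity of [S]. *)
have Smul a b c d : (a *: 1 + b *: p) * (c *: 1 + d *: p) =
    (a * c) *: 1 + (a * d + b * c + b * d) *: p.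
  rewrite mulrDl !mulrDr -!scalerAl -!scalerAr !mul1r mulr1 pp !scalerA.
  by rewrite !scalerDl !addrA.
have SM s t : S s -> S t -> S (s * t).
  by move=> [a [b ->]] [c [d ->]]; rewrite Smul; eexists; eexists.
have SC s t : S s -> S t -> s * t = t * s.
  move=> [a [b ->]] [c [d ->]]; rewrite !Smul (mulrC a c) (mulrC b d).
  by rewrite (mulrC a d) (mulrC b c) (addrC (d * a)).
have k1 : 1 <= k by rewrite ler1n.
have bP := banach_norm_renorm bN S1 SB SZ SM k1.
exists (banach_pack bP); split.
- apply/eqP; rewrite eq_le; apply/andP; split.
    apply: ge_ereal_inf; exists (renorm (@opnorm R) S k p)%:E.
      exists p; split => //; last exact: rshiftl_neq1.
      exists (rshift_op R), (lshift_op R); split => //.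
      by rewrite lshiftK.
    rewrite lee_fin; apply: le_trans (opnorm_rshiftl R).
    exact: (renorm_subset bN).
  apply/ereal_infP => _ [q [qq [a [b [qab ba]]] q1 ->]].
  rewrite lee_fin; apply: idem_norm_ge1 qq _.
  + exact: (banach_norm_ge0 bP).
  + exact: (banach_norm_eq0 bP).
  + exact: (banach_normM bP).
  (* With [q = a * b] and [b * a = 1], one has [1 = (b * a) * (b * a) = b * q * a], so [q = 0] would
     force [1 = 0]. *)
  + move=> q0; have /eqP := oner_neq0 (linfty_op R); apply.
    have : 1 * 1 = b * (a * b) * a.
      by rewrite ba -!mulrA.
    by rewrite -qab q0 mulr0 mul0r mulr1.
- apply/ereal_infP => _ [a [b [ab ba ->]]].
  rewrite lee_fin.
  (* The bound is taken in the operator norm, in which [renorm_commutator] measures the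
     commutator. *)
  have : 1 <= opnorm (a * b - b * a).
    rewrite ab; apply: idem_norm_ge1.
    + exact: opnorm_ge0.
    + exact: opnorm_eq0.
    + exact: opnormM.
    + by apply: subr_idem; rewrite mulrA -(mulrA b) ab mulr1.
    + by move=> /eqP; rewrite subr_eq0 => /eqP/esym.
  (* With [N] the operator norm and [P] its renorming, the chain is [2n <= k <= k * N (a * b - b *
     a) <= 2 * (P a * P b)]; the factor 2 then cancels. *)
  rewrite -(ler_pM2l (lt_le_trans ltr01 k1)) mulr1 => /le_trans.
  move=> /(_ _ (renorm_commutator bN S1 k1 a b SC)).
  have kn : 2 * n%:R <= k by rewrite -natrM ler_nat mul2n.
  by move=> /(le_trans kn); rewrite ler_pM2l.
Qed.
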